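(* Let $\mathcal{A} \subset M_n$ be a nilpotent operator algebra. Then the maximal length of a quantum chain for $\mathcal{A}$ equals the minimal size of an ordered partition of $\mathbb{C}^n$ into quantum antichains for $\mathcal{A}$.
   Context: $M_n=M_n(\mathbb{C})$ is identified with the linear operators on the Hilbert space $\mathbb{C}^n$. An operator algebra in $M_n$ is a complex linear subspace closed under products; it is nilpotent if all its elements are nilpotent matrices. A subspace $\mathcal{E}$ is invariant for $\mathcal{A}$ if $A(\mathcal{E})\subseteq\mathcal{E}$ for all $A\in\mathcal{A}$, and semi-invariant if $\mathcal{E}=\mathcal{E}_1\cap\mathcal{E}_2^\perp$ for some invariant subspaces $\mathcal{E}_2\subseteq\mathcal{E}_1$. A quantum antichain for $\mathcal{A}$ is a nonzero semi-invariant subspace $\mathcal{E}\subseteq\mathbb{C}^n$ with $P\mathcal{A}P=\{0\}$, where $P$ is the orthogonal projection onto $\mathcal{E}$. A quantum chain for $\mathcal{A}$ is a sequence $(v_1,\ldots,v_k)$ of nonzero vectors in $\mathbb{C}^n$ with $v_{i+1}\in\mathcal{A}v_i=\{Av_i:A\in\mathcal{A}\}$ for $1\le i<k$; its length is $k$. A partition into quantum antichains is an orthogonal decomposition $\mathbb{C}^n=\mathcal{E}_1\oplus\cdots\oplus\mathcal{E}_k$ in which each $\mathcal{E}_i$ is a quantum antichain for $\mathcal{A}$; its size is $k$. It is ordered if $\mathcal{E}_1\oplus\cdots\oplus\mathcal{E}_i$ is invariant for $\mathcal{A}$ for each $1\le i\le k$. *)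

(* Defs.v *)
From HB Require Import structures.
From mathcomp Require Import all_boot all_order all_algebra.
From mathcomp Require Import sesquilinear spectral complex reals.

Set Implicit Arguments.
Unset Strict Implicit.
Unset Printing Implicit Defensive.

Import Order.TTheory GRing.Theory Num.Theory.
Local Open Scope ring_scope.

Section Hilbert.
Context {C : numClosedFieldType} {n : nat}.
Implicit Types (u v : 'cV[C]_n) (E : {vspace 'cV[C]_n}).

(* The standard inner product sum_i u_i (v_i)^*, linear in the first argument;
   the library's [dotmx] is about row vectors. *)
Definition cdot u v : C := dotmx u^T v^T.

Lemma cdotE u v : cdot u v = \sum_i u i 0 * (v i 0)^*.
Proof. by rewrite /cdot dotmxE mxE; apply: eq_bigr => i _; rewrite !mxE. Qed.

Fact cdot_linearl u : GRing.linear_for (@GRing.mul C) (cdot^~ u).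
Proof. by move=> a v w; rewrite /cdot linearP linearPl. Qed.

Fact cdot_linearr u : GRing.linear_for (Num.conj \; *%R) (cdot u).
Proof. by move=> a v w; rewrite /cdot linearP linearPr. Qed.

HB.instance Definition _ := bilinear_isBilinear.Build C 'cV[C]_n 'cV[C]_n C
  (@GRing.mul C) (Num.conj \; *%R) cdot (conj cdot_linearl cdot_linearr).

Fact cdot_hermitian u v : cdot u v = (-1) ^+ false * (cdot v u)^*.
Proof. by rewrite /cdot hermC. Qed.

HB.instance Definition _ := isHermitianSesquilinear.Build C 'cV[C]_n false
  Num.conj cdot cdot_hermitian.

Fact cdot_gt0 u : u != 0 -> 0 < cdot u u.
Proof. by rewrite -trmx_eq0; exact: neq0_dnorm_gt0. Qed.

HB.instance Definition _ := isDotProduct.Build C 'cV[C]_n cdot cdot_gt0.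

Definition orthoc E : {vspace 'cV[C]_n} := orthov cdot E.

Lemma mem_orthocP E u : reflect {in E, forall v, cdot u v = 0} (u \in orthoc E).
Proof. exact: mem_orthovP. Qed.

Lemma orthoc_cap E : (E :&: orthoc E = 0)%VS.
Proof.
apply/eqP; rewrite -subv0; apply/subvP => u; rewrite memv_cap memv0.
move=> /andP[uE /mem_orthocP/(_ u uE) uu0]; apply/negPn/negP => /cdot_gt0.
by rewrite uu0 ltxx.
Qed.

Lemma orthoc_add E : (E + orthoc E = fullv)%VS.
Proof.
apply/eqP; rewrite eqEsubv subvf; apply/subvP => v _.
pose B : 'M_(\dim E, n) := \matrix_i ((vbasis E)`_i)^T.
pose w := v^T *m proj_ortho B.
have -> : v = w^T + (v - w^T) by rewrite addrC subrK.
apply: memv_add.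
  have /submxP[D ->] : (w <= B)%MS by exact: proj_ortho_sub.
  rewrite mulmx_sum_row linear_sum; apply: rpred_sum => i _.
  by rewrite linearZ /= rowK trmxK rpredZ// vbasis_mem// mem_nth// size_tuple.
apply/mem_orthocP => u /coord_vbasis->; rewrite linear_sumr big1 // => i _.
rewrite linearZr; apply/eqP; rewrite mulf_eq0; apply/orP; right; apply/eqP.
have := proj_ortho_compl_sub B v^T; rewrite -/w => /orthomx1P/matrixP/(_ 0 i).
rewrite !mxE => wB; rewrite -[RHS]wB [LHS]cdotE.
by apply: eq_bigr => j _; rewrite !mxE.
Qed.

Definition orthoproj E : 'End('cV[C]_n) := daddv_pi E (orthoc E).

Lemma orthoproj_mem E v : orthoproj E v \in E.
Proof. exact: memv_pi. Qed.

Lemma orthoproj_compl E v : v - orthoproj E v \in orthoc E.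
Proof.
have vE : v \in (E + orthoc E)%VS by rewrite orthoc_add memvf.
by rewrite -{1}(daddv_pi_add (orthoc_cap E) vE) addrC addKr memv_pi.
Qed.

Definition mxop (A : 'M[C]_n) : 'End('cV[C]_n) := linfun (mulmx A).

Lemma mxopE A v : mxop A v = A *m v.
Proof. by rewrite lfunE. Qed.

(* No unit is required, hence not an {aspace _}. *)
Definition operator_algebra (AA : {vspace 'M[C]_n}) : Prop :=
  forall A B, A \in AA -> B \in AA -> A *m B \in AA.

Definition nilpotent_mx (A : 'M[C]_n) : Prop := exists m : nat, A ^+ m = 0.

Definition nilpotent_algebra (AA : {vspace 'M[C]_n}) : Prop :=
  operator_algebra AA /\ forall A, A \in AA -> nilpotent_mx A.

Definition invariant_subspace (AA : {vspace 'M[C]_n}) E : Prop :=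
  forall A, A \in AA -> (mxop A @: E <= E)%VS.

Definition semi_invariant (AA : {vspace 'M[C]_n}) E : Prop :=
  exists E1 E2, [/\ invariant_subspace AA E1, invariant_subspace AA E2, (E2 <= E1)%VS
    & E = (E1 :&: orthoc E2)%VS].

Definition quantum_antichain (AA : {vspace 'M[C]_n}) E : Prop :=
  [/\ E != 0%VS, semi_invariant AA E
    & forall A, A \in AA -> (orthoproj E \o mxop A \o orthoproj E = 0)%VF].

(* The empty sequence is allowed (k = 0); this only matters when n = 0, where
   it is the only chain, matching the empty partition. *)
Definition quantum_chain (AA : {vspace 'M[C]_n}) k (v : 'I_k -> 'cV[C]_n) : Prop :=
  (forall i, v i != 0) /\
  (forall i j : 'I_k, j = i.+1 :> nat -> exists2 A, A \in AA & v j = A *m v i).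

Definition antichain_partition (AA : {vspace 'M[C]_n}) k
    (E : 'I_k -> {vspace 'cV[C]_n}) : Prop :=
  [/\ forall i j, i != j -> (E i <= orthoc (E j))%VS,
      (\sum_i E i)%VS = fullv
    & forall i, quantum_antichain AA (E i)].

Definition ordered_partition (AA : {vspace 'M[C]_n}) k
    (E : 'I_k -> {vspace 'cV[C]_n}) : Prop :=
  antichain_partition AA E /\
  forall i : 'I_k, invariant_subspace AA (\sum_(j < k | (j <= i)%N) E j)%VS.

End Hilbert.

Definition is_max (S : nat -> Prop) (m : nat) : Prop :=
  S m /\ forall k, S k -> (k <= m)%N.

Definition is_min (S : nat -> Prop) (m : nat) : Prop :=
  S m /\ forall k, S k -> (m <= k)%N.

(* Main.v *)
Require Import Defs.
From HB Require Import structures.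
From mathcomp Require Import all_boot all_order all_algebra.
From mathcomp Require Import sesquilinear spectral complex reals.

Set Implicit Arguments.
Unset Strict Implicit.
Unset Printing Implicit Defensive.

Import Order.TTheory GRing.Theory Num.Theory.
Local Open Scope ring_scope.
Local Open Scope complex_scope.

(** Let [V_0 = 0] and [V_(j+1) = {v | AA v <= V_j}]. A vector lies outside [V_j]
    exactly when some chain of length [j+1] starts at it, so the longest chain
    has length the least [m] with [V_m] the whole space. The increasing
    subspaces [V_j] are invariant and [AA V_(j+1) <= V_j], so the successive
    differences [V_(j+1) :&: V_j^perp], [j < m], form an ordered partition into
    antichains; conversely the partial sums of any ordered partition satisfy
    [E_1 + ... + E_j <= V_j]. Such an [m] exists because [v] is never in [AA v]
    unless [v = 0], so the orbits [AA v] of successive chain vectors strictly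
    decrease in dimension. *)

(** * The filtration, its relation to chains, and nilpotency *)

Section AnnihilatorFiltration.
Context {C : numClosedFieldType} {n : nat}.
Variable AA : {vspace 'M[C]_n}.
Implicit Types (A : 'M[C]_n) (v : 'cV[C]_n) (E : {vspace 'cV[C]_n}).

(** Intersecting preimages over a basis of [AA] makes each term a subspace by construction; by
    linearity the condition then holds for all of [AA]. *)
Fixpoint ann_filt (j : nat) : {vspace 'cV[C]_n} :=
  if j is j'.+1
  then (\bigcap_(i < \dim AA) mxop (vbasis AA)`_i @^-1: ann_filt j')%VS
  else 0%VS.

Lemma ann_filtSP j v :
  reflect (forall A, A \in AA -> A *m v \in ann_filt j) (v \in ann_filt j.+1).
Proof.
rewrite memvE; apply: (iffP subv_bigcapP) => [vV A AAA | vV i _].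
  rewrite (coord_vbasis AAA) mulmx_suml; apply: rpred_sum => i _.
  rewrite -scalemxAl rpredZ // -mxopE memv_preim.
  exact: (subvP (vV i isT)) (memv_line v).
rewrite -memvE -memv_preim mxopE; apply: vV.
by rewrite vbasis_mem // mem_nth // size_tuple.
Qed.

Lemma ann_filtPn j v : v \notin ann_filt j.+1 ->
  exists2 A, A \in AA & A *m v \notin ann_filt j.
Proof.
move=> vV.
(* A witness exists among the finitely many basis elements, so a decidable search finds it. *)
case: (pickP (fun i : 'I_(\dim AA) => (vbasis AA)`_i *m v \notin ann_filt j)).
  move=> i iV; exists (vbasis AA)`_i => //.
  by rewrite vbasis_mem // mem_nth // size_tuple.
move=> noi; case/negP: vV; rewrite memvE; apply/subv_bigcapP => i _.
by rewrite -memvE -memv_preim mxopE; have /negbFE := noi i.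
Qed.

Lemma ann_filt_subS j : (ann_filt j <= ann_filt j.+1)%VS.
Proof.
elim: j => [|j IHj]; first exact: sub0v.
apply/subvP => v /ann_filtSP vV; apply/ann_filtSP => A /vV.
exact: (subvP IHj).
Qed.

Lemma ann_filt_sub i j : (i <= j)%N -> (ann_filt i <= ann_filt j)%VS.
Proof.
move=> /subnK <-; elim: (j - i)%N => [|k IHk]; first exact: subvv.
exact: subv_trans IHk (ann_filt_subS _).
Qed.

(** Each term is determined by the previous one, so a single repetition persists. *)
Lemma ann_filt_stable i k :
  ann_filt i.+1 = ann_filt i -> ann_filt (k + i) = ann_filt i.
Proof.
move=> Vi; elim: k => // k IHk.
by rewrite -[RHS]Vi addSn /= IHk.
Qed.

Lemma ann_filt_invariant j : invariant_subspace AA (ann_filt j).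
Proof.
move=> A AAA; apply/subvP => _ /memv_imgP[v vV ->]; rewrite mxopE.
by have /ann_filtSP := subvP (ann_filt_subS j) v vV; apply.
Qed.

(** Each step of the chain lowers the filtration level by one, and level 0 has no nonzero vector.
    Indices start at 0, so [k - i] vectors remain from [v i] on. *)
Lemma quantum_chain_ann_filt k (v : 'I_k -> 'cV[C]_n) j (i : 'I_k) :
  quantum_chain AA v -> v i \in ann_filt j -> (k <= i + j)%N.
Proof.
move=> [v0 vS]; elim: j i => [|j IHj] i.
  by rewrite memv0 (negPf (v0 i)).
move=> /ann_filtSP vV; rewrite addnS -addSn.
case: (ltnP i.+1 k) => [ik|ki]; last exact: leq_trans ki (leq_addr _ _).
have [A AAA vA] := vS i (Ordinal ik) erefl.
by apply: (IHj (Ordinal ik)); rewrite vA vV.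
Qed.

(** Indexing [w] by [nat] makes it easy to prepend [v]; the values beyond [j] are junk. *)
Lemma ann_filt_chain j v : v \notin ann_filt j ->
  exists w : nat -> 'cV[C]_n, [/\ w 0%N = v,
    forall i, (i <= j)%N -> w i != 0
    & forall i, (i < j)%N -> exists2 A, A \in AA & w i.+1 = A *m w i].
Proof.
elim: j v => [|j IHj] v vV.
  exists (fun=> v); split=> // i _; by rewrite -memv0.
have v0 : v != 0 by apply: contraNneq vV => ->; exact: mem0v.
have [A AAA /IHj[w [w0 wn0 wS]]] := ann_filtPn vV.
exists (fun i => if i is i'.+1 then w i' else v); split=> //.
  by case=> [|i] // /wn0.
by case=> [_|i /wS //]; exists A.
Qed.

Lemma ann_filt_quantum_chain j : ann_filt j != fullv ->
  exists v : 'I_j.+1 -> 'cV[C]_n, quantum_chain AA v.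
Proof.
rewrite eqEsubv subvf /= => /subvPn[v _ /ann_filt_chain[w [_ wn0 wS]]].
exists (fun i => w i); split=> [i|i i' i'E]; first by rewrite wn0 // -ltnS.
by rewrite i'E; apply: wS; rewrite -ltnS -i'E.
Qed.

Definition orbit_space v : {vspace 'cV[C]_n} := (linfun (mulmxr v) @: AA)%VS.

Lemma orbit_spaceP v w :
  reflect (exists2 A, A \in AA & w = A *m v) (w \in orbit_space v).
Proof.
by apply: (iffP memv_imgP) => -[A AAA ->]; exists A; rewrite // lfunE.
Qed.

Hypothesis nilAA : nilpotent_algebra AA.

(** Iterating [v = A *m v] gives [v = A ^+ m *m v], and [A] is nilpotent. *)
Lemma mem_orbit_space v : v \in orbit_space v -> v = 0.
Proof.
move=> /orbit_spaceP[A /nilAA.2[m Am] vA].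
suff : v = A ^+ m *m v by rewrite Am mul0mx.
elim: m {Am} => [|m IHm]; first by rewrite expr0 mul1mx.
by rewrite exprSr -mulmxA -vA.
Qed.

(** If [A *m v] escapes the previous level, its orbit space lies in that of [v], strictly: [A *m v]
    belongs to the latter but, being nonzero, not to the former. *)
Lemma dim_orbit_space j v : v \notin ann_filt j -> (j <= \dim (orbit_space v))%N.
Proof.
elim: j v => [|j IHj] v //.
move=> /ann_filtPn[A AAA AvV]; apply: leq_ltn_trans (IHj _ AvV) _.
have sub : (orbit_space (A *m v) <= orbit_space v)%VS.
  apply/subvP => _ /orbit_spaceP[B BAA ->]; apply/orbit_spaceP.
  by exists (B *m A); rewrite ?mulmxA //; apply: nilAA.1.
rewrite (ltn_leqif (dimv_leqif_sup sub)); apply/negP => /subvP/(_ (A *m v)).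
have Avo : A *m v \in orbit_space v by apply/orbit_spaceP; exists A.
by move=> /(_ Avo)/mem_orbit_space Av0; move: AvV; rewrite Av0 mem0v.
Qed.

Lemma ann_filt_full : ann_filt n = fullv.
Proof.
apply/eqP; rewrite eqEsubv subvf; apply/subvP => v _; apply/negPn/negP => vV.
have dimCn : \dim {:'cV[C]_n} = n by rewrite dimvf; exact: muln1.
(* The orbit space of [v] has dimension at least [n], so it is everything and contains [v]. *)
have := dim_orbit_space vV; rewrite -{1}dimCn.
rewrite (geq_leqif (dimv_leqif_sup (subvf _))) => /subvP/(_ v (memvf v)).
by move=> /mem_orbit_space v0; rewrite v0 mem0v in vV.
Qed.

End AnnihilatorFiltration.

(** * Projections and differences of nested subspaces *)

Section OrthogonalDifferences.
Context {C : numClosedFieldType} {n : nat}.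
Implicit Types (v : 'cV[C]_n) (E F : {vspace 'cV[C]_n}).

Lemma orthoproj_id E v : v \in E -> orthoproj E v = v.
Proof. exact: daddv_pi_id (orthoc_cap E). Qed.

Lemma orthoproj_eq0 E v : (orthoproj E v == 0) = (v \in orthoc E).
Proof.
apply/eqP/idP => [Ev0|vE]; first by rewrite -[v]subr0 -Ev0 orthoproj_compl.
apply/eqP; rewrite -memv0 -(orthoc_cap E) memv_cap orthoproj_mem /=.
by rewrite -[orthoproj E v](subKr v) rpredB // orthoproj_compl.
Qed.

Lemma sub_orthoc_sym E F : (E <= orthoc F)%VS = (F <= orthoc E)%VS.
Proof.
suff sym (E' F' : {vspace 'cV[C]_n}) : (E' <= orthoc F')%VS -> (F' <= orthoc E')%VS.
  by apply/idP/idP; exact: sym.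
move=> /subvP EF; apply/subvP => v vF; apply/mem_orthocP => u /EF/mem_orthocP.
by move=> /(_ v vF) uv; rewrite [LHS]cdot_hermitian uv conjC0 mulr0.
Qed.

Lemma orthoc_diff_add E F : (F <= E)%VS -> (F + (E :&: orthoc F) = E)%VS.
Proof.
move=> FE; apply/eqP; rewrite eqEsubv subv_add FE capvSl; apply/subvP => v vE.
rewrite -[v](subrK (orthoproj F v)) addrC; apply: memv_add.
  exact: orthoproj_mem.
rewrite memv_cap orthoproj_compl rpredB // (subvP FE) //.
exact: orthoproj_mem.
Qed.

End OrthogonalDifferences.

(** * Ordered partitions compared with the filtration *)

Section Partitions.
Context {C : numClosedFieldType} {n : nat}.
Variable AA : {vspace 'M[C]_n}.
Local Notation V := (ann_filt AA).

Lemma sum_lt_recr k (E : 'I_k -> {vspace 'cV[C]_n}) (i : 'I_k) :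
  (\sum_(j < k | (j <= i)%N) E j = \sum_(j < k | (j < i)%N) E j + E i)%VS.
Proof.
rewrite (bigD1 i) //= addvC; congr (_ + _)%VS; apply: eq_bigl => j.
by rewrite andbC -ltn_neqAle.
Qed.

(** For [z] in the next block, invariance puts [A *m z] in the partial sum up to that block, and the
    antichain condition kills its component in the block; what is left lies in the earlier blocks,
    to which induction applies. *)
Lemma ordered_partition_sub k (E : 'I_k -> {vspace 'cV[C]_n}) j :
  ordered_partition AA E -> (j <= k)%N ->
  (\sum_(i < k | (i < j)%N) E i <= V j)%VS.
Proof.
move=> [[Eorth _ Eanti] Einv]; elim: j => [|j IHj] jk.
  by rewrite big_pred0.
pose i := Ordinal jk; pose F := (\sum_(l < k | (l < j)%N) E l)%VS.
have FS : (\sum_(l < k | (l < j.+1)%N) E l = F + E i)%VS.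
  exact: (sum_lt_recr E i).
have FE : (F <= orthoc (E i))%VS.
  apply/subv_sumP => l lj; apply: Eorth; by apply: contraTneq lj => ->; rewrite ltnn.
have inv_F : invariant_subspace AA F.
  (* Indices below [l.+1] are those at most [l], so the ordering applies at [l]; for [j = 0] the sum
     is zero. *)
  rewrite /F; case: (j) (jk) => [|l] lk; last exact: (Einv (Ordinal (ltnW lk))).
  by rewrite big_pred0 // => A _; rewrite limg0.
have inv_FE : invariant_subspace AA (F + E i)%VS by rewrite -FS; exact: (Einv i).
have sub_FV : (F <= V j)%VS by apply: IHj; exact: ltnW.
rewrite FS subv_add; apply/andP; split.
  exact: subv_trans sub_FV (ann_filt_subS _ _).
apply/subvP => z zE; apply/ann_filtSP => A AAA; apply: (subvP sub_FV).
have [_ _ /(_ A AAA)/lfunP/(_ z)] := Eanti i.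
rewrite !comp_lfunE (orthoproj_id zE) mxopE zero_lfunE => PAz.
have : A *m z \in (F + E i)%VS.
  rewrite -mxopE; apply: (subvP (inv_FE A AAA)); apply: memv_img.
  exact: (subvP (addvSr _ _)).
case/memv_addP => a aF [b bE Azab]; move: PAz; rewrite Azab linearD /=.
have /eqP-> : orthoproj (E i) a == 0 by rewrite orthoproj_eq0 (subvP FE).
by rewrite add0r orthoproj_id // => ->; rewrite addr0.
Qed.

Lemma ordered_partition_full k (E : 'I_k -> {vspace 'cV[C]_n}) :
  ordered_partition AA E -> V k = fullv.
Proof.
move=> hE; apply/eqP; rewrite eqEsubv subvf /=.
have [[_ <- _] _] := hE.
rewrite (eq_bigl (fun i : 'I_k => (i < k)%N)) => [|i]; last by rewrite ltn_ord.
exact: ordered_partition_sub.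
Qed.

Lemma ann_filt_ordered_partition m :
  V m = fullv -> (forall i, V i = fullv -> (m <= i)%N) ->
  ordered_partition AA (fun i : 'I_m => (V i.+1 :&: orthoc (V i))%VS).
Proof.
move=> Vm m_min; set E := fun i : 'I_m => _.
have EV j : (j <= m)%N -> (\sum_(i < m | (i < j)%N) E i = V j)%VS.
  elim: j => [|j IHj] jm; first by rewrite big_pred0.
  rewrite (sum_lt_recr E (Ordinal jm)) /= IHj; last exact: ltnW.
  exact: orthoc_diff_add (ann_filt_subS _ _).
have Eorth (i j : 'I_m) : (i < j)%N -> (E i <= orthoc (E j))%VS.
  move=> ij; rewrite sub_orthoc_sym; apply: subv_trans (capvSr _ _) _.
  rewrite sub_orthoc_sym; apply: subv_trans (capvSl _ _) _.
  rewrite sub_orthoc_sym; apply/subvP => v /mem_orthocP vj.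
  by apply/mem_orthocP => u uV; apply: vj; apply: (subvP (ann_filt_sub AA ij)).
split; last first.
  by move=> i; have := @ann_filt_invariant _ _ AA i.+1; rewrite -EV.
split=> [i j|| i].
- rewrite neq_ltn => /orP[/Eorth //|/Eorth]; by rewrite sub_orthoc_sym.
- rewrite -Vm -EV //; apply: eq_bigl => i; by rewrite ltn_ord.
split.
(* A zero block would make the filtration stop at [i], so [V i] would already be full, against the
   minimality of [m]. *)
- apply/negP => /eqP Ei0; have := orthoc_diff_add (ann_filt_subS AA i).
  rewrite [(_ :&: _)%VS]Ei0 addv0 => /esym Vi.
  have := ann_filt_stable (m - i) Vi; rewrite subnK; last exact: ltnW.
  by rewrite Vm => /esym/m_min; rewrite leqNgt ltn_ord.
- exists (V i.+1), (V i); split=> //; try exact: ann_filt_invariant.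
  exact: ann_filt_subS.
move=> A AAA; apply/lfunP => v; rewrite !comp_lfunE mxopE zero_lfunE.
apply/eqP; rewrite orthoproj_eq0.
(* [A] sends [E i] into [V i], which is orthogonal to [E i]. *)
have := orthoproj_mem (E i) v; rewrite {2}/E memv_cap => /andP[/ann_filtSP/(_ A AAA)].
move=> AV _; suff /subvP : (V i <= orthoc (E i))%VS by apply.
by rewrite sub_orthoc_sym capvSr.
Qed.

End Partitions.

Theorem theorem6p5 (R : realType) (n : nat) (AA : {vspace 'M[R[i]]_n})
    (hAA : nilpotent_algebra AA) :
  exists m : nat,
    is_max (fun k => exists v : 'I_k -> 'cV[R[i]]_n, quantum_chain AA v) m /\
    is_min (fun k => exists E : 'I_k -> {vspace 'cV[R[i]]_n},
              ordered_partition AA E) m.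
Proof.
have exV : exists j, ann_filt AA j == fullv.
  by exists n; apply/eqP; exact: ann_filt_full.
case: (ex_minnP exV) => m /eqP Vm m_min; exists m; split; split.
(* For [m = 0] the empty chain serves; otherwise the level just below [m] is not full and yields a
   chain of length [m]. *)
- case: m {Vm} m_min => [|m] m_min; first by exists (fun=> 0); split; case.
  apply: ann_filt_quantum_chain; by apply/negP => /m_min; rewrite ltnn.
- case=> // k [v vchain].
  by apply: (quantum_chain_ann_filt (i := ord0) vchain); rewrite Vm memvf.
- exists (fun i : 'I_m => (ann_filt AA i.+1 :&: orthoc (ann_filt AA i))%VS).
  by apply: ann_filt_ordered_partition => // i /eqP/m_min.
- by move=> k [E /ordered_partition_full/eqP/m_min].
Qed.
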